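(* Let $R$ be a right non-degenerate ring and let $(P,Q,\psi)$ be an $R$-system satisfying condition (FS). Then the Fock space representation $(S_{\mathcal{F}},T_{\mathcal{F}},\sigma_{\mathcal{F}},\mathcal{F}_{(P,Q,\psi)})$ of $(P,Q,\psi)$ is isomorphic to the Toeplitz representation $(\iota_P,\iota_Q,\iota_R,\mathcal{T}_{(P,Q,\psi)})$.
   Context: Rings are associative, not necessarily unital. For $R$-bimodules $P,Q$, $P\otimes Q$ is the $R$-balanced tensor product. ''Linear'' means additive. A ring $R$ is right non-degenerate if $rR=0$ implies $r=0$. An $R$-system is a triple $(P,Q,\psi)$ where $P,Q$ are $R$-bimodules and $\psi:P\otimes Q\to R$ is an $R$-bimodule homomorphism. A covariant representation of $(P,Q,\psi)$ is a quadruple $(S,T,\sigma,B)$ where $B$ is a ring, $S:P\to B$ and $T:Q\to B$ are linear maps, $\sigma:R\to B$ is a ring homomorphism, and $S(pr)=S(p)\sigma(r)$, $S(rp)=\sigma(r)S(p)$, $T(qr)=T(q)\sigma(r)$, $T(rq)=\sigma(r)T(q)$, $\sigma(\psi(p\otimes q))=S(p)T(q)$ for all $r\in R,p\in P,q\in Q$. It is surjective if $B$ is generated as a ring by $\sigma(R)\cup T(Q)\cup S(P)$. Two surjective covariant representations $(S_1,T_1,\sigma_1,B_1)$, $(S_2,T_2,\sigma_2,B_2)$ are isomorphic if there is a ring isomorphism $\phi:B_1\to B_2$ with $\phi\circ T_1=T_2$, $\phi\circ S_1=S_2$, $\phi\circ\sigma_1=\sigma_2$. The Toeplitz representation $(\iota_P,\iota_Q,\iota_R,\mathcal{T}_{(P,Q,\psi)})$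 is the (up to isomorphism unique) surjective covariant representation such that for every covariant representation $(S,T,\sigma,B)$ there is a unique ring homomorphism $\eta:\mathcal{T}_{(P,Q,\psi)}\to B$ with $\eta\circ\iota_R=\sigma$, $\eta\circ\iota_Q=T$, $\eta\circ\iota_P=S$. For $p\in P,q\in Q$: $\theta_{q,p}:Q\to Q$, $x\mapsto q\psi(p\otimes x)$, and $\theta_{p,q}:P\to P$, $y\mapsto\psi(y\otimes q)p$. $\mathcal{F}_P(Q)$ is the additive span of all $\theta_{q,p}$, $\mathcal{F}_Q(P)$ the additive span of all $\theta_{p,q}$. Condition (FS): for all finite sets $\{q_1,\dots,q_n\}\subseteq Q$, $\{p_1,\dots,p_m\}\subseteq P$ there exist $\Theta\in\mathcal{F}_P(Q)$ and $\Omega\in\mathcal{F}_Q(P)$ with $\Theta(q_i)=q_i$ and $\Omega(p_j)=p_j$ for all $i,j$. Fock space representation: let $Q^{\otimes0}=R$, let $Q^{\otimes n}$ be the $n$-fold tensor power over $R$, and $F(Q)=\bigoplus_{n\ge0}Q^{\otimes n}$, an $R$-bimodule. For $q\in Q$ let $T_q:F(Q)\to F(Q)$ be the right $R$-module map sending $q_0\in Q^{\otimes 0}=R$ to $qq_0\in Q$ and $q_n\in Q^{\otimes n}$ to $q\otimes q_n\in Q^{\otimes n+1}$ for $n\ge1$. For $p\in P$ let $S_p:F(Q)\to F(Q)$ be the right $R$-module map which is $0$ on $Q^{\otimes0}$, sends $q_1\in Q$ to $\psi(p\otimes q_1)\in R=Q^{\otimes 0}$, and sends $q_1\otimes q_2\in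 Q\otimes Q^{\otimes n}=Q^{\otimes n+1}$ to $\psi(p\otimes q_1)q_2\in Q^{\otimes n}$ for $n\ge1$. For $r\in R$ let $\phi_\infty(r):F(Q)\to F(Q)$ be $\{q_n\}\mapsto\{rq_n\}$. Put $T_{\mathcal{F}}(q)=T_q$, $S_{\mathcal{F}}(p)=S_p$, $\sigma_{\mathcal{F}}(r)=\phi_\infty(r)$, and let $\mathcal{F}_{(P,Q,\psi)}$ be the subring of the ring of right $R$-module endomorphisms of $F(Q)$ generated by $T_{\mathcal{F}}(Q)\cup S_{\mathcal{F}}(P)\cup\sigma_{\mathcal{F}}(R)$. Then $(S_{\mathcal{F}},T_{\mathcal{F}},\sigma_{\mathcal{F}},\mathcal{F}_{(P,Q,\psi)})$ is a surjective covariant representation of $(P,Q,\psi)$, called the Fock space representation. *)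

(* Defs.v *)
From HB Require Import structures.
From mathcomp Require Import all_boot all_order all_algebra.
From mathcomp Require Import boolp classical_sets functions.
From mathcomp Require Import freeg.

Set Implicit Arguments.
Unset Strict Implicit.
Unset Printing Implicit Defensive.

Import GRing.Theory.
Local Open Scope ring_scope.
Local Open Scope classical_set_scope.
Local Open Scope quotient_scope.

(* Rings without unit.  MathComp's ring structures all have a unit, hence a   *)
(* new structure on top of zmodType; the carrier being a choiceType is no     *)
(* restriction in the classical setting of [boolp].                           *)

HB.mixin Record Zmodule_isNuRing V of GRing.Zmodule V := {
  nmul : V -> V -> V;
  nmulA : associative nmul;
  nmulDl : left_distributive nmul +%R;
  nmulDr : right_distributive nmul +%R
}.

#[short(type="nuRingType")]
HB.structure Definition NuRing :=
  {V of GRing.Zmodule V & Zmodule_isNuRing V}.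

Notation "x ** y" := (nmul x y) (at level 40, left associativity) : ring_scope.

HB.mixin Record isNuMultiplicative (A B : nuRingType) (f : A -> B) := {
  nmorphM : {morph f : x y / x ** y}
}.

HB.structure Definition NuRMorphism (A B : nuRingType) :=
  {f of @GRing.Additive A B f & isNuMultiplicative A B f}.

Notation "{ 'nurmorphism' A -> B }" := (NuRMorphism.type A%type B%type)
  (at level 0, A at level 98, B at level 99,
   format "{ 'nurmorphism'  A  ->  B }") : type_scope.

HB.mixin Record Zmodule_isBimodule (R : nuRingType) M of GRing.Zmodule M := {
  lact : R -> M -> M;
  ract : M -> R -> M;
  lactDl : forall r s m, lact (r + s) m = lact r m + lact s m;
  lactDr : forall r m n, lact r (m + n) = lact r m + lact r n;
  lactA : forall r s m, lact (r ** s) m = lact r (lact s m);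
  ractDl : forall m n r, ract (m + n) r = ract m r + ract n r;
  ractDr : forall m r s, ract m (r + s) = ract m r + ract m s;
  ractA : forall m r s, ract m (r ** s) = ract (ract m r) s;
  lractA : forall r m s, ract (lact r m) s = lact r (ract m s)
}.

#[short(type="bimodType")]
HB.structure Definition Bimodule (R : nuRingType) :=
  {M of GRing.Zmodule M & Zmodule_isBimodule R M}.

Notation "r *> m" := (lact r m) (at level 40, left associativity) : ring_scope.
Notation "m <* r" := (ract m r) (at level 40, left associativity) : ring_scope.

Section NuRingTheory.
Variable A : nuRingType.
Implicit Types x y : A.

Lemma nmul0l x : 0 ** x = 0.
Proof. by apply: (@addrI _ (0 ** x)); rewrite -nmulDl !addr0. Qed.
Lemma nmul0r x : x ** 0 = 0.
Proof. by apply: (@addrI _ (x ** 0)); rewrite -nmulDr !addr0. Qed.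
Lemma nmulNl x y : (- x) ** y = - (x ** y).
Proof. by apply: (@addrI _ (x ** y)); rewrite -nmulDl !subrr nmul0l. Qed.
Lemma nmulNr x y : x ** (- y) = - (x ** y).
Proof. by apply: (@addrI _ (x ** y)); rewrite -nmulDr !subrr nmul0r. Qed.
End NuRingTheory.

Section BimoduleTheory.
Variables (R : nuRingType) (M : bimodType R).
Implicit Types (r : R) (m : M).

Lemma lact0l m : 0 *> m = 0 :> M.
Proof. by apply: (@addrI _ ((0 : R) *> m)); rewrite -lactDl !addr0. Qed.
Lemma lact0r r : r *> 0 = 0 :> M.
Proof. by apply: (@addrI _ (r *> 0)); rewrite -lactDr !addr0. Qed.
Lemma lactNr r m : r *> (- m) = - (r *> m).
Proof. by apply: (@addrI _ (r *> m)); rewrite -lactDr !subrr lact0r. Qed.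
Lemma ract0l r : 0 <* r = 0 :> M.
Proof. by apply: (@addrI _ ((0 : M) <* r)); rewrite -ractDl !addr0. Qed.
Lemma ract0r m : m <* (0 : R) = 0.
Proof. by apply: (@addrI _ (m <* (0 : R))); rewrite -ractDr !addr0. Qed.
Lemma ractNl m r : (- m) <* r = - (m <* r).
Proof. by apply: (@addrI _ (m <* r)); rewrite -ractDl !subrr ract0l. Qed.
End BimoduleTheory.

Definition regular (R : nuRingType) : Type := R.
HB.instance Definition _ (R : nuRingType) := GRing.Zmodule.on (regular R).
HB.instance Definition _ (R : nuRingType) :=
  Zmodule_isBimodule.Build R (regular R)
    (fun r s t => nmulDl r s t) (fun r s t => nmulDr r s t)
    (fun r s t => esym (nmulA r s t))
    (fun r s t => nmulDl r s t) (fun r s t => nmulDr r s t)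
    (fun r s t => nmulA r s t) (fun r s t => esym (nmulA r s t)).

Definition right_nondegenerate (R : nuRingType) : Prop :=
  forall r : R, (forall s : R, r ** s = 0) -> r = 0.

(* [smallest is_subgroup A] is the additive span of A, and                    *)
(* [smallest is_subring A] the ring generated by A.                           *)

Definition is_subgroup (V : zmodType) (S : set V) : Prop :=
  S 0 /\ (forall x y, S x -> S y -> S (x - y)).
Arguments is_subgroup {V} S.

Definition is_subring (A : nuRingType) (S : set A) : Prop :=
  is_subgroup S /\ (forall x y, S x -> S y -> S (x ** y)).
Arguments is_subring {A} S.

Lemma is_subgroup_span (V : zmodType) (A : set V) :
  is_subgroup (smallest is_subgroup A).
Proof.
split=> [S [[S0 _] _] //|x y xA yA S SA].
by have [[_ SB] _] := SA; apply: SB; [apply: xA|apply: yA].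
Qed.

Lemma is_subring_gen (B : nuRingType) (A : set B) :
  is_subring (smallest is_subring A).
Proof.
split; first split=> [S [[[S0 _] _] _] //|x y xA yA S SA].
  by have [[[_ SB] _] _] := SA; apply: SB; [apply: xA|apply: yA].
move=> x y xA yA S SA.
by have [[_ SM] _] := SA; apply: SM; [apply: xA|apply: yA].
Qed.

(* Balanced tensor product: free abelian group on M * N modulo the subgroup   *)
(* generated by the biadditivity and balancing relations.                     *)

Section Tensor.
Variables (R : nuRingType) (M N : bimodType R).

Inductive tensor_rel : set {freeg (M * N)%type / int} :=
| TensorDl m m' n : tensor_rel (<< (m + m', n) >> - << (m, n) >> - << (m', n) >>)
| TensorDr m n n' : tensor_rel (<< (m, n + n') >> - << (m, n) >> - << (m, n') >>)
| TensorB m r n : tensor_rel (<< (m <* r, n) >> - << (m, r *> n) >>).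

Definition tensor_sub : {pred {freeg (M * N)%type / int}} :=
  fun x => `[< smallest is_subgroup tensor_rel x >].

Fact tensor_sub_closed : zmod_closed tensor_sub.
Proof.
have [h0 hB] := is_subgroup_span tensor_rel.
by split=> [|x y /asboolP xS /asboolP yS]; apply/asboolP => //; apply: hB.
Qed.

HB.instance Definition _ :=
  GRing.isZmodClosed.Build _ tensor_sub tensor_sub_closed.

Local Notation tquot := (Quotient.quot tensor_sub).

Definition tensor : Type := tquot.
HB.instance Definition _ := GRing.Zmodule.on tensor.

Definition tensor_pi (x : {freeg (M * N)%type / int}) : tensor := \pi_tquot x.

Fact tensor_piB : zmod_morphism tensor_pi.
Proof. exact: (raddfB \pi_tquot). Qed.
HB.instance Definition _ :=
  GRing.isZmodMorphism.Build _ tensor tensor_pi tensor_piB.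

Definition pure (m : M) (n : N) : tensor := tensor_pi << (m, n) >>.

Fact tensor_pi_repr (x : tensor) : tensor_pi (repr x) = x.
Proof. exact: reprK. Qed.

Fact tensor_pi_eq x y :
  tensor_pi x = tensor_pi y <-> smallest is_subgroup tensor_rel (x - y).
Proof.
split=> [/eqP|xy]; last apply/eqP; rewrite /tensor_pi -Quotient.idealrBE.
  by move=> /asboolP.
exact/asboolP.
Qed.

Fact tensor_pi0 x : tensor_rel x -> tensor_pi x = 0.
Proof.
move=> hx; rewrite -(raddf0 tensor_pi); apply/tensor_pi_eq.
by rewrite subr0; apply: sub_gen_smallest.
Qed.

Lemma pureDl m m' n : pure (m + m') n = pure m n + pure m' n.
Proof.
apply/eqP; rewrite -subr_eq0 opprD addrA -!raddfB; apply/eqP.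
exact/tensor_pi0/TensorDl.
Qed.

Lemma pureDr m n n' : pure m (n + n') = pure m n + pure m n'.
Proof.
apply/eqP; rewrite -subr_eq0 opprD addrA -!raddfB; apply/eqP.
exact/tensor_pi0/TensorDr.
Qed.

Lemma pureB m r n : pure (m <* r) n = pure m (r *> n).
Proof.
apply/eqP; rewrite -subr_eq0 -raddfB; apply/eqP.
exact/tensor_pi0/TensorB.
Qed.

Lemma pure0l n : pure 0 n = 0.
Proof. by apply: (@addrI _ (pure 0 n)); rewrite -pureDl !addr0. Qed.
Lemma pure0r m : pure m 0 = 0.
Proof. by apply: (@addrI _ (pure m 0)); rewrite -pureDr !addr0. Qed.
Lemma pureNl m n : pure (- m) n = - pure m n.
Proof. by apply: (@addrI _ (pure m n)); rewrite -pureDl !subrr pure0l. Qed.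

Lemma tensorW (K : tensor -> Prop) :
  K 0 -> (forall m n x, K x -> K (pure m n + x)) -> forall x, K x.
Proof.
move=> K0 KD x; rewrite -(tensor_pi_repr x).
have KB m n y : K y -> K (y - pure m n).
  by move=> Ky; rewrite addrC -pureNl; apply: KD.
elim/freeg_ind_dom0: (repr x) => [|k [m n] D _ _ IH].
  by rewrite raddf0.
rewrite raddfD addrC -[k]intz -freegU_mulz raddfMz -/(pure m n).
case: k => j; [rewrite -pmulrn|rewrite NegzE mulrNz -pmulrn].
  elim: j => [|j IHj]; first by rewrite mulr0n addr0.
  by rewrite mulrSr addrA addrC; apply: KD.
elim: j.+1 => [|i IHi]; first by rewrite mulr0n subr0.
by rewrite mulrSr opprD addrA; apply: KB.
Qed.

(* The map out of the tensor product induced by f; for f not balanced and     *)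
(* biadditive its value is irrelevant.                                        *)
Section Lift.
Variables (A : zmodType) (f : M -> N -> A).

Definition tensor_lift (x : tensor) : A :=
  fglift (fun mn => f mn.1 mn.2 : zmodule A) (repr x).

Hypothesis fDl : forall m m' n, f (m + m') n = f m n + f m' n.
Hypothesis fDr : forall m n n', f m (n + n') = f m n + f m n'.
Hypothesis fB : forall m r n, f (m <* r) n = f m (r *> n).

Let F := fglift (fun mn => f mn.1 mn.2 : zmodule A).

Let FB : zmod_morphism (F : {freeg (M * N)%type / int} -> A).
Proof. exact: (@lift_is_additive _ _ (zmodule A) (fun mn => f mn.1 mn.2)). Qed.

Let FU mn : F << mn >> = f mn.1 mn.2.
Proof. by rewrite /F liftU scale1r. Qed.

Let F_sub x : smallest is_subgroup tensor_rel x -> F x = 0 :> A.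
Proof.
move: x; apply: (smallest_sub (X := [set x | F x = 0 :> A])).
  split=> [|x y /= Fx Fy]; last by rewrite FB Fx Fy subr0.
  by rewrite /= -[X in F X](subrr 0) FB subrr.
move=> x [m m' n|m n n'|m r n] /=; rewrite !FB !FU /=.
- by rewrite fDl addrAC addrK subrr.
- by rewrite fDr addrAC addrK subrr.
- by rewrite fB subrr.
Qed.

Let lift_pi x : tensor_lift (tensor_pi x) = F x.
Proof.
apply/eqP; rewrite -subr_eq0 -FB; apply/eqP/F_sub.
by apply/tensor_pi_eq; rewrite tensor_pi_repr.
Qed.

Lemma tensor_lift_pure m n : tensor_lift (pure m n) = f m n.
Proof. by rewrite lift_pi FU. Qed.

Lemma tensor_liftB : zmod_morphism tensor_lift.
Proof.
move=> x y; rewrite -(tensor_pi_repr x) -(tensor_pi_repr y).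
by rewrite -raddfB !lift_pi FB.
Qed.

Lemma tensor_lift0 : tensor_lift 0 = 0.
Proof. by rewrite -[X in tensor_lift X](subrr 0) tensor_liftB subrr. Qed.
Lemma tensor_liftN : {morph tensor_lift : x / - x}.
Proof. by move=> x; rewrite -[- x]add0r tensor_liftB tensor_lift0 sub0r. Qed.
Lemma tensor_liftD : {morph tensor_lift : x y / x + y}.
Proof. by move=> x y; rewrite -{1}[y]opprK tensor_liftB tensor_liftN opprK. Qed.

End Lift.

Lemma tensor_lift_ext (A : zmodType) (f g : M -> N -> A) :
  (forall m n, f m n = g m n) -> tensor_lift f = tensor_lift g.
Proof.
by move=> fg; have -> : f = g by apply/funext=> m; apply/funext=> n.
Qed.

Lemma tensor_ext (A : zmodType) (f g : tensor -> A) :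
  {morph f : x y / x + y} -> {morph g : x y / x + y} ->
  (forall m n, f (pure m n) = g (pure m n)) -> f =1 g.
Proof.
move=> fD gD fg; apply: tensorW => [|m n x IH]; last by rewrite fD gD fg IH.
rewrite -(pure0l 0); exact: fg.
Qed.

Definition tensor_lact (r : R) : tensor -> tensor :=
  tensor_lift (fun m n => pure (r *> m) n).
Definition tensor_ract (x : tensor) (r : R) : tensor :=
  tensor_lift (fun m n => pure m (n <* r)) x.

Fact tensor_lact_pure r m n : tensor_lact r (pure m n) = pure (r *> m) n.
Proof.
apply: (@tensor_lift_pure _ (fun m n => pure (r *> m) n)) => [m1 m2 n1|m1 n1 n2|m1 s n1].
- by rewrite lactDr pureDl.
- exact: pureDr.
- by rewrite -lractA pureB.
Qed.

Fact tensor_ract_pure m n r : tensor_ract (pure m n) r = pure m (n <* r).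
Proof.
apply: (@tensor_lift_pure _ (fun m n => pure m (n <* r))) => [m1 m2 n1|m1 n1 n2|m1 s n1].
- exact: pureDl.
- by rewrite ractDl pureDr.
- by rewrite pureB lractA.
Qed.

Fact tensor_lactDr r : {morph tensor_lact r : x y / x + y}.
Proof.
apply: tensor_liftD => [m1 m2 n1|m1 n1 n2|m1 s n1].
- by rewrite lactDr pureDl.
- exact: pureDr.
- by rewrite -lractA pureB.
Qed.

Fact tensor_ractDl r : {morph tensor_ract^~ r : x y / x + y}.
Proof.
apply: tensor_liftD => [m1 m2 n1|m1 n1 n2|m1 s n1].
- exact: pureDl.
- by rewrite ractDl pureDr.
- by rewrite pureB lractA.
Qed.

Fact tensor_lactDl r s x :
  tensor_lact (r + s) x = tensor_lact r x + tensor_lact s x.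
Proof.
move: x; apply: tensor_ext => [||m n]; first exact: tensor_lactDr.
  by move=> x y; rewrite !tensor_lactDr addrACA.
by rewrite !tensor_lact_pure lactDl pureDl.
Qed.

Fact tensor_ractDr x r s :
  tensor_ract x (r + s) = tensor_ract x r + tensor_ract x s.
Proof.
move: x; apply: tensor_ext => [||m n]; first exact: tensor_ractDl.
  by move=> x y; rewrite !tensor_ractDl addrACA.
by rewrite !tensor_ract_pure ractDr pureDr.
Qed.

Fact tensor_lactA r s x :
  tensor_lact (r ** s) x = tensor_lact r (tensor_lact s x).
Proof.
move: x; apply: tensor_ext => [||m n]; first exact: tensor_lactDr.
  by move=> x y; rewrite !tensor_lactDr.
by rewrite !tensor_lact_pure lactA.
Qed.

Fact tensor_ractA x r s :
  tensor_ract x (r ** s) = tensor_ract (tensor_ract x r) s.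
Proof.
move: x; apply: tensor_ext => [||m n]; first exact: tensor_ractDl.
  by move=> x y; rewrite !tensor_ractDl.
by rewrite !tensor_ract_pure ractA.
Qed.

Fact tensor_lractA r x s :
  tensor_ract (tensor_lact r x) s = tensor_lact r (tensor_ract x s).
Proof.
move: x; apply: tensor_ext => [||m n].
- by move=> x y; rewrite tensor_lactDr tensor_ractDl.
- by move=> x y; rewrite tensor_ractDl tensor_lactDr.
by rewrite tensor_lact_pure !tensor_ract_pure tensor_lact_pure.
Qed.

HB.instance Definition _ := Zmodule_isBimodule.Build R tensor
  tensor_lactDl tensor_lactDr tensor_lactA
  (fun x y r => tensor_ractDl r x y) tensor_ractDr tensor_ractA tensor_lractA.

Lemma lact_pure r m n : r *> pure m n = pure (r *> m) n.
Proof. exact: tensor_lact_pure. Qed.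
Lemma ract_pure m n r : pure m n <* r = pure m (n <* r).
Proof. exact: tensor_ract_pure. Qed.

End Tensor.

Section DirectSum.
Variables (R : nuRingType) (M : nat -> bimodType R).

Definition dprod : Type := forall n, M n.
HB.instance Definition _ := Choice.on dprod.

Let dadd (x y : dprod) : dprod := fun n => x n + y n.
Let dopp (x : dprod) : dprod := fun n => - x n.
Let daddA : associative dadd.
Proof. by move=> x y z; apply: functional_extensionality_dep => n; exact: addrA. Qed.
Let daddC : commutative dadd.
Proof. by move=> x y; apply: functional_extensionality_dep => n; exact: addrC. Qed.
Let dadd0 : left_id (fun n => 0) dadd.
Proof. by move=> x; apply: functional_extensionality_dep => n; exact: add0r. Qed.
Let daddN : left_inverse (fun n => 0) dopp dadd.
Proof. by move=> x; apply: functional_extensionality_dep => n; exact: addNr. Qed.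
HB.instance Definition _ :=
  GRing.isZmodule.Build dprod daddA daddC dadd0 daddN.

Definition finsupp (x : forall n, M n) : Prop :=
  exists N, forall n, (N <= n)%N -> x n = 0.

Definition dsum_pred : {pred dprod} := fun x => `[< finsupp x >].

Fact dsum_closed : zmod_closed dsum_pred.
Proof.
split=> [|x y /asboolP[N xN] /asboolP[N' yN]]; apply/asboolP; first by exists 0%N.
exists (maxn N N') => n; rewrite geq_max => /andP[Nn N'n].
by rewrite -[LHS]/(x n - y n) xN// yN// subrr.
Qed.
HB.instance Definition _ := GRing.isZmodClosed.Build _ dsum_pred dsum_closed.

Definition dsum : Type := {x : dprod | dsum_pred x}.
HB.instance Definition _ := [isSub of dsum for @sval _ _].
HB.instance Definition _ := [Choice of dsum by <:].
HB.instance Definition _ := [SubChoice_isSubZmodule of dsum by <:].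

Definition dcoord (n : nat) (x : dsum) : M n := (val x : dprod) n.

Definition dsum_of (x : forall n, M n) (h : finsupp x) : dsum :=
  exist _ (x : dprod) (asboolT h).

Lemma dsum_ext (x y : dsum) : (forall n, dcoord n x = dcoord n y) -> x = y.
Proof. by move=> xy; apply/val_inj/functional_extensionality_dep. Qed.

Lemma dsum_supp (x : dsum) : finsupp (fun n => dcoord n x).
Proof. by case: x => x h; exact/asboolP. Qed.

Lemma dcoord_of n x (h : finsupp x) : dcoord n (dsum_of h) = x n.
Proof. by []. Qed.
Lemma dcoord0 n : dcoord n 0 = 0. Proof. by []. Qed.
Lemma dcoordD n x y : dcoord n (x + y) = dcoord n x + dcoord n y.
Proof. by []. Qed.
Lemma dcoordN n x : dcoord n (- x) = - dcoord n x.
Proof. by []. Qed.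
Lemma dcoordB n x y : dcoord n (x - y) = dcoord n x - dcoord n y.
Proof. by []. Qed.

Fact dsum_lact_subproof (r : R) (x : dsum) : finsupp (fun n => r *> dcoord n x).
Proof. by have [N xN] := dsum_supp x; exists N => n /xN ->; rewrite lact0r. Qed.
Fact dsum_ract_subproof (x : dsum) (r : R) : finsupp (fun n => dcoord n x <* r).
Proof. by have [N xN] := dsum_supp x; exists N => n /xN ->; rewrite ract0l. Qed.

Definition dsum_lact r x : dsum := dsum_of (dsum_lact_subproof r x).
Definition dsum_ract x r : dsum := dsum_of (dsum_ract_subproof x r).

Fact dsum_lactDl r s x : dsum_lact (r + s) x = dsum_lact r x + dsum_lact s x.
Proof. by apply: dsum_ext => n; exact: lactDl. Qed.
Fact dsum_lactDr r x y : dsum_lact r (x + y) = dsum_lact r x + dsum_lact r y.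
Proof. by apply: dsum_ext => n; exact: lactDr. Qed.
Fact dsum_lactA r s x : dsum_lact (r ** s) x = dsum_lact r (dsum_lact s x).
Proof. by apply: dsum_ext => n; exact: lactA. Qed.
Fact dsum_ractDl x y r : dsum_ract (x + y) r = dsum_ract x r + dsum_ract y r.
Proof. by apply: dsum_ext => n; exact: ractDl. Qed.
Fact dsum_ractDr x r s : dsum_ract x (r + s) = dsum_ract x r + dsum_ract x s.
Proof. by apply: dsum_ext => n; exact: ractDr. Qed.
Fact dsum_ractA x r s : dsum_ract x (r ** s) = dsum_ract (dsum_ract x r) s.
Proof. by apply: dsum_ext => n; exact: ractA. Qed.
Fact dsum_lractA r x s :
  dsum_ract (dsum_lact r x) s = dsum_lact r (dsum_ract x s).
Proof. by apply: dsum_ext => n; exact: lractA. Qed.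

HB.instance Definition _ := Zmodule_isBimodule.Build R dsum
  dsum_lactDl dsum_lactDr dsum_lactA
  dsum_ractDl dsum_ractDr dsum_ractA dsum_lractA.

Lemma dcoord_lact n (r : R) (x : dsum) : dcoord n (r *> x) = r *> dcoord n x.
Proof. by []. Qed.
Lemma dcoord_ract n (x : dsum) (r : R) : dcoord n (x <* r) = dcoord n x <* r.
Proof. by []. Qed.
End DirectSum.

Section RightEndomorphisms.
Variables (R : nuRingType) (M : bimodType R).

Definition right_linear (f : M -> M) : Prop :=
  {morph f : x y / x + y} /\ (forall x (r : R), f (x <* r) = f x <* r).

Definition rend_pred : {pred (M -> M)} := fun f => `[< right_linear f >].

Fact rend_closed : zmod_closed rend_pred.
Proof.
split=> [|f g /asboolP[fD fZ] /asboolP[gD gZ]]; apply/asboolP; split.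
- by move=> x y; rewrite -[LHS]/0 -[RHS]/(0 + 0) addr0.
- by move=> x r; rewrite -[LHS]/0 -[RHS]/(0 <* r) ract0l.
- move=> x y; rewrite -[LHS]/(f (x + y) - g (x + y)).
  by rewrite fD gD opprD addrACA.
- move=> x r; rewrite -[LHS]/(f (x <* r) - g (x <* r)) fZ gZ.
  by rewrite -[RHS]/((f x - g x) <* r) ractDl ractNl.
Qed.
HB.instance Definition _ := GRing.isZmodClosed.Build _ rend_pred rend_closed.

Definition rend : Type := {f : M -> M | rend_pred f}.
HB.instance Definition _ := [isSub of rend for @sval _ _].
HB.instance Definition _ := [Choice of rend by <:].
HB.instance Definition _ := [SubChoice_isSubZmodule of rend by <:].

Definition rend_fun (f : rend) : M -> M := val f.
Coercion rend_fun : rend >-> Funclass.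

Definition rend_of (f : M -> M) (h : right_linear f) : rend :=
  exist _ f (asboolT h).

Lemma rendP (f : rend) : right_linear f.
Proof. by case: f => f h; exact/asboolP. Qed.
Lemma rend_ext (f g : rend) : f =1 g -> f = g.
Proof. by move=> fg; apply/val_inj/funext. Qed.
Lemma rendD (f : rend) : {morph f : x y / x + y}.
Proof. exact: (rendP f).1. Qed.
Lemma rend_ract (f : rend) x (r : R) : f (x <* r) = f x <* r.
Proof. exact: (rendP f).2. Qed.

Fact rend_mul_subproof (f g : rend) : right_linear (f \o g).
Proof. by split=> x y /=; rewrite !(rendD, rend_ract). Qed.
Definition rend_mul (f g : rend) : rend := rend_of (rend_mul_subproof f g).

Fact rend_mulA : associative rend_mul.
Proof. by move=> f g h; apply: rend_ext. Qed.
Fact rend_mulDl : left_distributive rend_mul +%R.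
Proof. by move=> f g h; apply: rend_ext. Qed.
Fact rend_mulDr : right_distributive rend_mul +%R.
Proof. by move=> f g h; apply: rend_ext => x; exact: rendD. Qed.
HB.instance Definition _ :=
  Zmodule_isNuRing.Build rend rend_mulA rend_mulDl rend_mulDr.

Lemma rendDE (f g : rend) x : (f + g : rend) x = f x + g x. Proof. by []. Qed.
Lemma rendNE (f : rend) x : (- f : rend) x = - f x. Proof. by []. Qed.
Lemma rend0E x : (0 : rend) x = 0. Proof. by []. Qed.
Lemma rendME (f g : rend) x : (f ** g : rend) x = f (g x). Proof. by []. Qed.
End RightEndomorphisms.

Section GeneratedSubring.
Variables (B : nuRingType) (A : set B).

Definition gen_pred : {pred B} := fun x => `[< smallest is_subring A x >].

Fact gen_closed : zmod_closed gen_pred.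
Proof.
have [[h0 hB] _] := is_subring_gen A.
by split=> [|x y /asboolP xS /asboolP yS]; apply/asboolP => //; apply: hB.
Qed.
HB.instance Definition _ := GRing.isZmodClosed.Build _ gen_pred gen_closed.

Definition gen : Type := {x : B | gen_pred x}.
HB.instance Definition _ := [isSub of gen for @sval _ _].
HB.instance Definition _ := [Choice of gen by <:].
HB.instance Definition _ := [SubChoice_isSubZmodule of gen by <:].

Definition gen_of (x : B) (h : A x) : gen :=
  exist _ x (asboolT (sub_gen_smallest h)).

Fact gen_mul_subproof (x y : gen) : gen_pred (val x ** val y).
Proof.
case: x y => x xS [y yS] /=; apply/asboolP.
by apply: (is_subring_gen A).2; apply/asboolP.
Qed.
Definition gen_mul (x y : gen) : gen :=
  exist (fun z => gen_pred z) _ (gen_mul_subproof x y).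

Fact gen_mulA : associative gen_mul.
Proof. by move=> x y z; apply/val_inj; exact: nmulA. Qed.
Fact gen_mulDl : left_distributive gen_mul +%R.
Proof. by move=> x y z; apply/val_inj; exact: nmulDl. Qed.
Fact gen_mulDr : right_distributive gen_mul +%R.
Proof. by move=> x y z; apply/val_inj; exact: nmulDr. Qed.
HB.instance Definition _ :=
  Zmodule_isNuRing.Build gen gen_mulA gen_mulDl gen_mulDr.

Lemma gen_valM (x y : gen) : val (x ** y) = val x ** val y.
Proof. by []. Qed.

Lemma gen_generated : smallest is_subring [set x : gen | A (val x)] = setT.
Proof.
apply/seteqP; split=> // x _ S [[[S0 SB] SM] SA].
pose S' := [set y | exists2 z : gen, S z & val z = y].
suff [z Sz /val_inj <- //] : S' (val x).
suff: smallest is_subring A `<=` S' by apply; case: x => x xA; exact/asboolP.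
apply: smallest_sub => [|y Ay]; last by exists (gen_of Ay) => //; exact: SA.
split; first split.
- by exists 0 => //; rewrite raddf0.
- by move=> _ _ [y Sy <-] [z Sz <-]; exists (y - z); [exact: SB|rewrite raddfB].
- by move=> _ _ [y Sy <-] [z Sz <-]; exists (y ** z) => //; exact: SM.
Qed.
End GeneratedSubring.

Record rsystem (R : nuRingType) := RSystem {
  sysP : bimodType R;
  sysQ : bimodType R;
  sys_psi : {additive tensor sysP sysQ -> R};
  sys_psi_lact : forall r x, sys_psi (r *> x) = r ** sys_psi x;
  sys_psi_ract : forall x r, sys_psi (x <* r) = sys_psi x ** r
}.

Section CovariantRepresentations.
Variables (R : nuRingType) (X : rsystem R).
Local Notation P := (sysP X).
Local Notation Q := (sysQ X).

Definition psi (p : P) (q : Q) : R := sys_psi X (pure p q).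

Lemma psiDl p p' q : psi (p + p') q = psi p q + psi p' q.
Proof. by rewrite /psi pureDl raddfD. Qed.
Lemma psiDr p q q' : psi p (q + q') = psi p q + psi p q'.
Proof. by rewrite /psi pureDr raddfD. Qed.
Lemma psiB p r q : psi (p <* r) q = psi p (r *> q).
Proof. by rewrite /psi pureB. Qed.
Lemma psi_lact r p q : psi (r *> p) q = r ** psi p q.
Proof. by rewrite /psi -lact_pure sys_psi_lact. Qed.
Lemma psi_ract p q r : psi p (q <* r) = psi p q ** r.
Proof. by rewrite /psi -ract_pure sys_psi_ract. Qed.
Lemma psi0l q : psi 0 q = 0. Proof. by rewrite /psi pure0l raddf0. Qed.
Lemma psi0r p : psi p 0 = 0. Proof. by rewrite /psi pure0r raddf0. Qed.

Definition theta_Q (q : Q) (p : P) : Q -> Q := fun x => q <* psi p x.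
Definition theta_P (p : P) (q : Q) : P -> P := fun y => psi y q *> p.

Definition F_P_Q : set (Q -> Q) :=
  smallest is_subgroup [set f | exists q p, f = theta_Q q p].
Definition F_Q_P : set (P -> P) :=
  smallest is_subgroup [set f | exists p q, f = theta_P p q].

Definition conditionFS : Prop :=
  forall (qs : seq Q) (ps : seq P), exists (Theta : Q -> Q) (Omega : P -> P),
    [/\ F_P_Q Theta, F_Q_P Omega,
        forall q, q \in qs -> Theta q = q & forall p, p \in ps -> Omega p = p].

Record covrep := CovRep {
  cov_ring : nuRingType;
  cov_S : {additive P -> cov_ring};
  cov_T : {additive Q -> cov_ring};
  cov_sigma : {nurmorphism R -> cov_ring};
  cov_S_ract : forall p r, cov_S (p <* r) = cov_S p ** cov_sigma r;
  cov_S_lact : forall r p, cov_S (r *> p) = cov_sigma r ** cov_S p;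
  cov_T_ract : forall q r, cov_T (q <* r) = cov_T q ** cov_sigma r;
  cov_T_lact : forall r q, cov_T (r *> q) = cov_sigma r ** cov_T q;
  cov_psi : forall p q, cov_sigma (psi p q) = cov_S p ** cov_T q
}.

Definition cov_surjective (C : covrep) : Prop :=
  smallest is_subring
    (range (cov_sigma C) `|` range (cov_T C) `|` range (cov_S C)) = setT.

Definition cov_intertwines (C D : covrep) (f : cov_ring C -> cov_ring D) : Prop :=
  [/\ forall r, f (cov_sigma C r) = cov_sigma D r,
      forall q, f (cov_T C q) = cov_T D q &
      forall p, f (cov_S C p) = cov_S D p].

Definition cov_isomorphic (C D : covrep) : Prop :=
  exists phi : {nurmorphism cov_ring C -> cov_ring D},
    bijective phi /\ cov_intertwines phi.

Definition is_toeplitz (C : covrep) : Prop :=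
  cov_surjective C /\
  forall D : covrep,
    (exists eta : {nurmorphism cov_ring C -> cov_ring D}, cov_intertwines eta) /\
    (forall eta eta' : {nurmorphism cov_ring C -> cov_ring D},
       cov_intertwines eta -> cov_intertwines eta' -> eta =1 eta').

End CovariantRepresentations.

(* The degree 1 summand of the Fock space is Q itself and not Q (x) R, which  *)
(* may differ from Q as R need not have a unit; hence the case distinctions   *)
(* below.                                                                     *)

Section Fock.
Variables (R : nuRingType) (X : rsystem R).
Local Notation P := (sysP X).
Local Notation Q := (sysQ X).

Fixpoint tensor_powS (n : nat) : bimodType R :=
  if n is n'.+1 then tensor Q (tensor_powS n') else Q.

Definition tensor_pow (n : nat) : bimodType R :=
  if n is n'.+1 then tensor_powS n' else regular R.

Definition fock_space : bimodType R := dsum tensor_pow.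

Definition creation (q : Q) (n : nat) : tensor_pow n -> tensor_pow n.+1 :=
  match n return tensor_pow n -> tensor_pow n.+1 with
  | 0 => fun r : R => q <* r
  | n'.+1 => fun x => pure q x
  end.

Definition annihilation (p : P) (n : nat) : tensor_pow n.+1 -> tensor_pow n :=
  match n return tensor_pow n.+1 -> tensor_pow n with
  | 0 => fun q : Q => psi p q
  | n'.+1 => tensor_lift (fun (q : Q) (x : tensor_pow n'.+1) => psi p q *> x)
  end.

Lemma creationDr q n : {morph @creation q n : x y / x + y}.
Proof. by case: n => [|n] x y; [exact: ractDr|exact: pureDr]. Qed.
Lemma creationDl q q' n x :
  @creation (q + q') n x = @creation q n x + @creation q' n x.
Proof. by case: n x => [|n] x; [exact: ractDl|exact: pureDl]. Qed.
Lemma creation_ract q n x (r : R) : @creation q n (x <* r) = @creation q n x <* r.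
Proof. by case: n x => [|n] x; [exact: ractA|rewrite /= ract_pure]. Qed.
Lemma creation_lact q n x (r : R) : @creation (r *> q) n x = r *> @creation q n x.
Proof. by case: n x => [|n] x; [exact: lractA|rewrite /= lact_pure]. Qed.
Lemma creation_balanced q n x (r : R) : @creation (q <* r) n x = @creation q n (r *> x).
Proof. by case: n x => [|n] x; [rewrite /= -ractA|exact: pureB]. Qed.
Lemma creation0 q n : @creation q n 0 = 0.
Proof. by apply: (@addrI _ (@creation q n 0)); rewrite -creationDr !addr0. Qed.

Lemma annihilation_pure p n q x :
  @annihilation p n.+1 (pure q x) = psi p q *> x.
Proof.
apply: (@tensor_lift_pure _ _ _ _ (fun q x => psi p q *> x)) => [q1 q2 y|q1 y z|q1 r y].
- by rewrite psiDr lactDl.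
- exact: lactDr.
- by rewrite psi_ract lactA.
Qed.

Lemma annihilationDr p n : {morph @annihilation p n : x y / x + y}.
Proof.
case: n => [|n]; first by move=> x y; exact: psiDr.
apply: tensor_liftD => [q1 q2 y|q1 y z|q1 r y].
- by rewrite psiDr lactDl.
- exact: lactDr.
- by rewrite psi_ract lactA.
Qed.
Lemma annihilation0 p n : @annihilation p n 0 = 0.
Proof. by apply: (@addrI _ (@annihilation p n 0)); rewrite -annihilationDr !addr0. Qed.

Lemma annihilationDl p p' n x :
  @annihilation (p + p') n x = @annihilation p n x + @annihilation p' n x.
Proof.
case: n x => [|n]; first by move=> x; exact: psiDl.
apply: tensor_ext => [||q y]; first exact: (@annihilationDr (p + p') n.+1).
  by move=> y z; rewrite !annihilationDr addrACA.
by rewrite !annihilation_pure psiDl lactDl.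
Qed.
Lemma annihilation_ract p n x (r : R) :
  @annihilation p n (x <* r) = @annihilation p n x <* r.
Proof.
case: n x => [|n]; first by move=> x; exact: psi_ract.
apply: tensor_ext => [y z|y z|q y]; try by rewrite ?(ractDl, annihilationDr).
by rewrite ract_pure !annihilation_pure lractA.
Qed.
Lemma annihilation_lact p n x (r : R) :
  @annihilation (r *> p) n x = r *> @annihilation p n x.
Proof.
case: n x => [|n]; first by move=> x; exact: psi_lact.
apply: tensor_ext => [y z|y z|q y]; try by rewrite ?annihilationDr ?lactDr.
by rewrite !annihilation_pure psi_lact lactA.
Qed.
Lemma annihilation_balanced p n x (r : R) :
  @annihilation (p <* r) n x = @annihilation p n (r *> x).
Proof.
case: n x => [|n]; first by move=> x; exact: psiB.
apply: tensor_ext => [y z|y z|q y]; try by rewrite ?lactDr ?annihilationDr.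
by rewrite lact_pure !annihilation_pure psiB.
Qed.

Lemma annihilation_creation p q n x :
  @annihilation p n (@creation q n x) = psi p q *> x.
Proof. by case: n x => [|n] x; [exact: psi_ract|exact: annihilation_pure]. Qed.

Definition fock_T_fun (q : Q) (x : fock_space) (n : nat) : tensor_pow n :=
  if n is n'.+1 then @creation q n' (dcoord n' x) else 0.

Fact fock_T_subproof q x : finsupp (fock_T_fun q x).
Proof.
have [N xN] := dsum_supp x; exists N.+1 => -[|n] //= /xN ->; exact: creation0.
Qed.

Definition fock_S_fun (p : P) (x : fock_space) (n : nat) : tensor_pow n :=
  @annihilation p n (dcoord n.+1 x).

Fact fock_S_subproof p x : finsupp (fock_S_fun p x).
Proof.
have [N xN] := dsum_supp x; exists N => n Nn.
by rewrite /fock_S_fun xN ?annihilation0 // ltnW.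
Qed.

Fact fock_T_linear q :
  right_linear (fun x : fock_space => dsum_of (fock_T_subproof q x) : fock_space).
Proof.
split=> x y; apply: dsum_ext => -[|n] //=.
- by rewrite dcoordD !dcoord_of /= addr0.
- exact: creationDr.
- by rewrite dcoord_ract !dcoord_of /= ract0l.
- exact: creation_ract.
Qed.

Fact fock_S_linear p :
  right_linear (fun x : fock_space => dsum_of (fock_S_subproof p x) : fock_space).
Proof.
by split=> x y; apply: dsum_ext => n; [exact: annihilationDr|exact: annihilation_ract].
Qed.

Fact fock_sigma_linear (r : R) : right_linear (fun x : fock_space => r *> x).
Proof. by split=> x y; [exact: lactDr|rewrite lractA]. Qed.

Definition fock_T (q : Q) : rend fock_space := rend_of (fock_T_linear q).
Definition fock_S (p : P) : rend fock_space := rend_of (fock_S_linear p).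
Definition fock_sigma (r : R) : rend fock_space := rend_of (fock_sigma_linear r).

Definition fock_gens : set (rend fock_space) :=
  range fock_T `|` range fock_S `|` range fock_sigma.

Definition fock_ring : nuRingType := gen fock_gens.

Fact fock_T_in q : fock_gens (fock_T q). Proof. by left; left; exists q. Qed.
Fact fock_S_in p : fock_gens (fock_S p). Proof. by left; right; exists p. Qed.
Fact fock_sigma_in r : fock_gens (fock_sigma r). Proof. by right; exists r. Qed.

Definition fockT (q : Q) : fock_ring := gen_of (fock_T_in q).
Definition fockS (p : P) : fock_ring := gen_of (fock_S_in p).
Definition fockR (r : R) : fock_ring := gen_of (fock_sigma_in r).

Let fock_ext (a b : fock_ring) :
  (forall x n, dcoord n ((val a : rend fock_space) x) =
               dcoord n ((val b : rend fock_space) x)) -> a = b.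
Proof.
by move=> ab; apply/val_inj/rend_ext => x; apply: dsum_ext => n; exact: ab.
Qed.

Fact fockT_add : nmod_morphism fockT.
Proof.
have D : {morph fockT : x y / x + y}.
  move=> q q'; apply: fock_ext => x [|n]; last exact: creationDl.
  exact: esym (addr0 _).
by split=> //; apply: (@addrI _ (fockT 0)); rewrite -D !addr0.
Qed.
Fact fockS_add : nmod_morphism fockS.
Proof.
have D : {morph fockS : x y / x + y}.
  by move=> p p'; apply: fock_ext => x n; exact: annihilationDl.
by split=> //; apply: (@addrI _ (fockS 0)); rewrite -D !addr0.
Qed.
Fact fockR_add : nmod_morphism fockR.
Proof.
have D : {morph fockR : x y / x + y}.
  by move=> r r'; apply: fock_ext => x n; exact: lactDl.
by split=> //; apply: (@addrI _ (fockR 0)); rewrite -D !addr0.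
Qed.
Fact fockR_mul : {morph fockR : x y / x ** y}.
Proof. by move=> r r'; apply: fock_ext => x n; exact: lactA. Qed.

HB.instance Definition _ := GRing.isNmodMorphism.Build _ _ fockT fockT_add.
HB.instance Definition _ := GRing.isNmodMorphism.Build _ _ fockS fockS_add.
HB.instance Definition _ := GRing.isNmodMorphism.Build _ _ fockR fockR_add.
HB.instance Definition _ := isNuMultiplicative.Build _ _ fockR fockR_mul.

Fact fockS_ract p r : fockS (p <* r) = fockS p ** fockR r.
Proof. by apply: fock_ext => x n; exact: annihilation_balanced. Qed.
Fact fockS_lact r p : fockS (r *> p) = fockR r ** fockS p.
Proof. by apply: fock_ext => x n; exact: annihilation_lact. Qed.
Fact fockT_ract q r : fockT (q <* r) = fockT q ** fockR r.
Proof. by apply: fock_ext => x [|n] //; exact: creation_balanced. Qed.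
Fact fockT_lact r q : fockT (r *> q) = fockR r ** fockT q.
Proof.
apply: fock_ext => x [|n]; last exact: creation_lact.
exact: esym (lact0r _ _).
Qed.
Fact fock_psi p q : fockR (psi p q) = fockS p ** fockT q.
Proof. by apply: fock_ext => x n; exact: esym (annihilation_creation _ _ _). Qed.

Definition fock : covrep X :=
  @CovRep R X fock_ring fockS fockT fockR
    fockS_ract fockS_lact fockT_ract fockT_lact fock_psi.

Lemma fock_surjective : cov_surjective fock.
Proof.
rewrite /cov_surjective -[RHS](@gen_generated _ fock_gens); congr smallest.
apply/seteqP; split=> x /=.
  by case=> [[]|] [y _ <-]; [exact: fock_sigma_in|exact: fock_T_in|exact: fock_S_in].
case=> [[]|] [y _ yx]; [left; right|right|left; left];
  by exists y => //; apply/val_inj.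
Qed.

End Fock.

(* Existence of the Toeplitz representation: ring expressions in the elements *)
(* of R, Q and P, identified when they agree in every covariant               *)
(* representation.                                                            *)

Section ToeplitzExists.
Variables (R : nuRingType) (X : rsystem R).
Local Notation P := (sysP X).
Local Notation Q := (sysQ X).

Inductive texpr :=
| TexprR of R | TexprQ of Q | TexprP of P
| Texpr0 | TexprN of texpr | TexprD of texpr & texpr | TexprM of texpr & texpr.

Fixpoint teval (D : covrep X) (t : texpr) : cov_ring D :=
  match t with
  | TexprR r => cov_sigma D r
  | TexprQ q => cov_T D q
  | TexprP p => cov_S D p
  | Texpr0 => 0
  | TexprN a => - teval D a
  | TexprD a b => teval D a + teval D b
  | TexprM a b => teval D a ** teval D b
  end.

Let tequiv (a b : {classic texpr}) : bool :=
  `[< forall D, teval D a = teval D b >].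
Let tequiv_equiv : equiv_class_of tequiv.
Proof.
split=> [a|a b|b a c]; first exact/asboolP.
  by apply/asboolP/asboolP => h D.
by move=> /asboolP ab /asboolP bc; apply/asboolP => D; rewrite ab.
Qed.
Let trel := EquivRelPack tequiv_equiv.

Definition tring : Type := {eq_quot trel}.
HB.instance Definition _ := Choice.on tring.

Let tpi (a : texpr) : tring := \pi_({eq_quot trel}) (a : {classic texpr}).
Let tval (D : covrep X) (x : tring) : cov_ring D := teval D (repr x).
Let tvalE D a : tval D (tpi a) = teval D a.
Proof.
have /eqmodP/asboolP : \pi_({eq_quot trel}) (repr (tpi a)) = tpi a by exact: reprK.
exact.
Qed.
Let tring_ext (x y : tring) : (forall D, tval D x = tval D y) -> x = y.
Proof.
by move=> xy; rewrite -[x]reprK -[y]reprK; apply/eqmodP/asboolP.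
Qed.

Let tadd (x y : tring) := tpi (TexprD (repr x) (repr y)).
Let topp (x : tring) := tpi (TexprN (repr x)).
Let tmul (x y : tring) := tpi (TexprM (repr x) (repr y)).

Let taddA : associative tadd.
Proof. by move=> x y z; apply: tring_ext => D; rewrite !tvalE /= -!/(tval _ _) !tvalE; exact: addrA. Qed.
Let taddC : commutative tadd.
Proof. by move=> x y; apply: tring_ext => D; rewrite !tvalE; exact: addrC. Qed.
Let tadd0 : left_id (tpi Texpr0) tadd.
Proof. by move=> x; apply: tring_ext => D; rewrite !tvalE /= -!/(tval _ _) !tvalE; exact: add0r. Qed.
Let taddN : left_inverse (tpi Texpr0) topp tadd.
Proof. by move=> x; apply: tring_ext => D; rewrite !tvalE /= -!/(tval _ _) !tvalE; exact: addNr. Qed.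
HB.instance Definition _ := GRing.isZmodule.Build tring taddA taddC tadd0 taddN.

Let tmulA : associative tmul.
Proof. by move=> x y z; apply: tring_ext => D; rewrite !tvalE /= -!/(tval _ _) !tvalE; exact: nmulA. Qed.
Let tmulDl : left_distributive tmul +%R.
Proof. by move=> x y z; apply: tring_ext => D; rewrite !tvalE /= -!/(tval _ _) !tvalE; exact: nmulDl. Qed.
Let tmulDr : right_distributive tmul +%R.
Proof. by move=> x y z; apply: tring_ext => D; rewrite !tvalE /= -!/(tval _ _) !tvalE; exact: nmulDr. Qed.
HB.instance Definition _ := Zmodule_isNuRing.Build tring tmulA tmulDl tmulDr.

Let tvalD D : {morph tval D : x y / x + y}.
Proof. by move=> x y; rewrite tvalE. Qed.
Let tvalN D : {morph tval D : x / - x}.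
Proof. by move=> x; rewrite tvalE. Qed.
Let tval0 D : tval D 0 = 0.
Proof. by rewrite tvalE. Qed.
Let tvalM D : {morph tval D : x y / x ** y}.
Proof. by move=> x y; rewrite tvalE. Qed.
Let tvalB D : nmod_morphism (tval D). Proof. by split; [exact: tval0|exact: tvalD]. Qed.

Definition tR (r : R) : tring := tpi (TexprR r).
Definition tQ (q : Q) : tring := tpi (TexprQ q).
Definition tP (p : P) : tring := tpi (TexprP p).

Let tR_add : nmod_morphism tR.
Proof. by split=> [|x y]; apply: tring_ext => D; rewrite ?tvalD ?tval0 !tvalE /= ?raddf0 ?raddfD. Qed.
Let tQ_add : nmod_morphism tQ.
Proof. by split=> [|x y]; apply: tring_ext => D; rewrite ?tvalD ?tval0 !tvalE /= ?raddf0 ?raddfD. Qed.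
Let tP_add : nmod_morphism tP.
Proof. by split=> [|x y]; apply: tring_ext => D; rewrite ?tvalD ?tval0 !tvalE /= ?raddf0 ?raddfD. Qed.
Let tR_mul : {morph tR : x y / x ** y}.
Proof. by move=> x y; apply: tring_ext => D; rewrite tvalM !tvalE /= nmorphM. Qed.
HB.instance Definition _ := GRing.isNmodMorphism.Build _ _ tR tR_add.
HB.instance Definition _ := GRing.isNmodMorphism.Build _ _ tQ tQ_add.
HB.instance Definition _ := GRing.isNmodMorphism.Build _ _ tP tP_add.
HB.instance Definition _ := isNuMultiplicative.Build _ _ tR tR_mul.

Let tP_ract p r : tP (p <* r) = tP p ** tR r.
Proof. by apply: tring_ext => D; rewrite tvalM !tvalE; exact: cov_S_ract. Qed.
Let tP_lact r p : tP (r *> p) = tR r ** tP p.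
Proof. by apply: tring_ext => D; rewrite tvalM !tvalE; exact: cov_S_lact. Qed.
Let tQ_ract q r : tQ (q <* r) = tQ q ** tR r.
Proof. by apply: tring_ext => D; rewrite tvalM !tvalE; exact: cov_T_ract. Qed.
Let tQ_lact r q : tQ (r *> q) = tR r ** tQ q.
Proof. by apply: tring_ext => D; rewrite tvalM !tvalE; exact: cov_T_lact. Qed.
Let t_psi p q : tR (psi p q) = tP p ** tQ q.
Proof. by apply: tring_ext => D; rewrite tvalM !tvalE; exact: cov_psi. Qed.

Definition toeplitz : covrep X :=
  @CovRep R X tring tP tQ tR tP_ract tP_lact tQ_ract tQ_lact t_psi.

Lemma toeplitz_is_toeplitz : is_toeplitz toeplitz.
Proof.
have surj : cov_surjective toeplitz.
  apply/seteqP; split=> // x _ S [[[S0 SB] SM] SA].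
  have SN y : S y -> S (- y) by move=> Sy; rewrite -sub0r; exact: SB.
  rewrite -[x]reprK -[\pi _]/(tpi _); elim: (repr x) => [r|q|p||a IHa|a IHa b IHb|a IHa b IHb].
  - by apply: SA; left; left; exists r.
  - by apply: SA; left; right; exists q.
  - by apply: SA; right; exists p.
  - exact: S0.
  - suff -> : tpi (TexprN a) = - tpi a by exact: SN.
    by apply: tring_ext => D; rewrite tvalN !tvalE.
  - suff -> : tpi (TexprD a b) = tpi a - - tpi b by apply: SB => //; exact: SN.
    by apply: tring_ext => D; rewrite opprK tvalD !tvalE.
  - suff -> : tpi (TexprM a b) = tpi a ** tpi b by exact: SM.
    by apply: tring_ext => D; rewrite tvalM !tvalE.
split=> // D; split.
  pose m := GRing.isNmodMorphism.Build _ _ (tval D) (tvalB D).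
  pose m' := isNuMultiplicative.Build _ _ (tval D) (@tvalM D).
  pose f : {nurmorphism tring -> cov_ring D} := HB.pack (tval D) m m'.
  by exists f; split=> y; exact: tvalE.
move=> f g [fR fQ fP] [gR gQ gP] x.
have : smallest is_subring
    (range (cov_sigma toeplitz) `|` range (cov_T toeplitz) `|` range (cov_S toeplitz)) x.
  by rewrite surj.
move: x; apply: (smallest_sub (X := [set x | f x = g x])).
  split; first split=> [|x y /= fx fy]; rewrite /= ?raddf0 //.
  - by rewrite [LHS]raddfB [RHS]raddfB; congr (_ - _).
  - by move=> x y /= fx fy; rewrite !nmorphM fx fy.
by move=> _ [[]|] [y _ <-] /=; rewrite ?fR ?fQ ?fP ?gR ?gQ ?gP.
Qed.

End ToeplitzExists.

(* Main.v *)
(* In a surjective covariant representation, condition (FS) puts every        *)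
(* element in normal order, creation operators (the values of T) to the left  *)
(* of annihilation operators (the values of S).  The universal homomorphism f *)
(* from the Toeplitz ring to the Fock ring is surjective; it is injective     *)
(* because the number of operators can be lowered one by one.  (FS) gives     *)
(* e = sum_j T(q_j) S(p_j) with e T(q) = T(q) and S(p) e = S(p) for any given *)
(* finite set of q's, resp. p's.  If x = sigma(r) + y is made of creation     *)
(* operators only and f(x) kills the vacuum R, then r R = 0, hence r = 0 and  *)
(* x = e x, where the shorter elements S(p_j) x again kill the vacuum.  If    *)
(* x = a + sum_i y_i S(p_i) with a made of creation operators and f(x) = 0,   *)
(* then f(a) kills the vacuum, hence a = 0 and x = x e, where the x T(q_j)    *)
(* are in the kernel of f and have fewer annihilation operators.              *)

From HB Require Import structures.
From mathcomp Require Import all_boot all_algebra.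
From mathcomp Require Import boolp classical_sets.
Require Import Defs.

Set Implicit Arguments.
Unset Strict Implicit.
Unset Printing Implicit Defensive.

Import GRing.Theory.
Local Open Scope ring_scope.
Local Open Scope classical_set_scope.

(** The universal property yields a homomorphism [f] from the Toeplitz ring whose image contains the
    generators of the Fock ring, so everything rests on injectivity. Condition (FS) stands in for a
    unit ([FS_left_unit], [FS_right_unit]), and the contraction [S p ** T q = sigma (psi p q)]
    brings every element to normal order ([normal_ordered_exists]). Non-degeneracy makes the degree
    0 summand detect [sigma r]; contracting against the local units then reduces longer words to
    this case ([creation_part_faithful], [normal_ordered_faithful]). *)

Lemma nmul_suml (A : nuRingType) I (s : seq I) (F : I -> A) x :
  (\sum_(i <- s) F i) ** x = \sum_(i <- s) F i ** x.
Proof. by apply: (big_morph (nmul^~ x)) => [y z|]; rewrite ?nmulDl ?nmul0l. Qed.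

Lemma nmul_sumr (A : nuRingType) I (s : seq I) (F : I -> A) x :
  x ** (\sum_(i <- s) F i) = \sum_(i <- s) x ** F i.
Proof. by apply: (big_morph (nmul x)) => [y z|]; rewrite ?nmulDr ?nmul0r. Qed.

(** * Local units and normal ordering in a covariant representation *)

Section FiniteRank.
Variables (R : nuRingType) (X : rsystem R).
Local Notation P := (sysP X).
Local Notation Q := (sysQ X).

(** Signs are absorbed into the [Q] factor, so no integer coefficients are needed. *)
Lemma F_P_Q_sum (Theta : Q -> Q) : F_P_Q (X := X) Theta ->
  exists s : seq (Q * P), forall x, Theta x = \sum_(z <- s) z.1 <* psi z.2 x.
Proof.
move: Theta; apply: (smallest_sub (X := [set f | exists s : seq (Q * P),
  forall x, f x = \sum_(z <- s) z.1 <* psi z.2 x])).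
  split=> [|f g [s fs] [t gt]]; first by exists [::] => x; rewrite big_nil.
  exists (s ++ [seq (- z.1, z.2) | z <- t]) => x.
  rewrite big_cat big_map -fs -[LHS]/(f x - g x) gt -sumrN /=.
  by congr (_ + _); apply: eq_bigr => z _; rewrite ractNl.
by move=> _ [q [p ->]]; exists [:: (q, p)] => x; rewrite big_seq1.
Qed.

Lemma F_Q_P_sum (Omega : P -> P) : F_Q_P (X := X) Omega ->
  exists s : seq (Q * P), forall y, Omega y = \sum_(z <- s) psi y z.1 *> z.2.
Proof.
move: Omega; apply: (smallest_sub (X := [set f | exists s : seq (Q * P),
  forall y, f y = \sum_(z <- s) psi y z.1 *> z.2])).
  split=> [|f g [s fs] [t gt]]; first by exists [::] => x; rewrite big_nil.
  exists (s ++ [seq (z.1, - z.2) | z <- t]) => x.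
  rewrite big_cat big_map -fs -[LHS]/(f x - g x) gt -sumrN /=.
  by congr (_ + _); apply: eq_bigr => z _; rewrite lactNr.
by move=> _ [p [q ->]]; exists [:: (q, p)] => x; rewrite big_seq1.
Qed.

Variables (C : covrep X) (hFS : conditionFS X).
Local Notation B := (cov_ring C).
Local Notation S := (cov_S C).
Local Notation T := (cov_T C).
Local Notation sigma := (cov_sigma C).

(** By covariance [T q ** (S p ** T x) = T (theta_Q q p x)], so an operator [Theta] fixing [qs]
    becomes a left unit for their images. *)
Lemma FS_left_unit (qs : seq Q) : exists s : seq (Q * P),
  forall q, q \in qs -> \sum_(z <- s) T z.1 ** (S z.2 ** T q) = T q.
Proof.
have [Theta [_ [/F_P_Q_sum[s sE] _ Tq _]]] := hFS qs [::].
exists s => q /Tq {2}<-; rewrite sE raddf_sum.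
by apply: eq_bigr => z _; rewrite -cov_psi -cov_T_ract.
Qed.

Lemma FS_right_unit (ps : seq P) : exists s : seq (Q * P),
  forall p, p \in ps -> \sum_(z <- s) S p ** T z.1 ** S z.2 = S p.
Proof.
have [_ [Omega [_ /F_Q_P_sum[s sE] _ Op]]] := hFS [::] ps.
exists s => p /Op {2}<-; rewrite sE raddf_sum.
by apply: eq_bigr => z _; rewrite -cov_psi -cov_S_lact.
Qed.

(* [creation_part m] consists of the sums of products                         *)
(* [T q1 ** ... ** T qk ** sigma r] with [k <= m].                            *)
Fixpoint creation_part (m : nat) (x : B) : Prop :=
  if m is m'.+1 then
    exists (r : R) (s : seq (Q * B)),
      (forall z, z \in s -> creation_part m' z.2) /\
      x = sigma r + \sum_(z <- s) T z.1 ** z.2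
  else exists r, x = sigma r.

Lemma creation_part_sigma m r : creation_part m (sigma r).
Proof. by case: m => [|m]; exists r => //; exists [::]; rewrite big_nil addr0. Qed.

Lemma creation_partS m x : creation_part m x -> creation_part m.+1 x.
Proof.
elim: m x => [|m IH] x [r]; first by move=> ->; exact: creation_part_sigma.
by case=> s [sE ->]; exists r, s; split=> // z /sE /IH.
Qed.

Lemma creation_part_leq m n x :
  (m <= n)%N -> creation_part m x -> creation_part n x.
Proof.
by move=> /subnK <-; elim: (n - m)%N => [//|k IH] /IH; exact: creation_partS.
Qed.

Lemma creation_partB m x y :
  creation_part m x -> creation_part m y -> creation_part m (x - y).
Proof.
case: m => [[r ->] [t ->]|m [r [s [sE ->]]] [r' [s' [sE' ->]]]].
  by exists (r - t); rewrite raddfB.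
exists (r - r'), (s ++ [seq (- z.1, z.2) | z <- s']); split=> [z|].
  by rewrite mem_cat => /orP[/sE //|/mapP[w /sE' ? ->]].
rewrite big_cat big_map raddfB opprD addrACA -sumrN; congr (_ + (_ + _)).
by apply: eq_bigr => z _; rewrite /= raddfN nmulNl.
Qed.

Lemma creation_part0 m : creation_part m 0.
Proof. by rewrite -(raddf0 sigma); exact: creation_part_sigma. Qed.

Lemma creation_partD m x y :
  creation_part m x -> creation_part m y -> creation_part m (x + y).
Proof.
move=> mx my; rewrite -[y]opprK -[- y]sub0r; apply: creation_partB => //.
by apply: creation_partB => //; exact: creation_part0.
Qed.

Lemma creation_part_lact m r x :
  creation_part m x -> creation_part m (sigma r ** x).
Proof.
case: m => [[t ->]|m [t [s [sE ->]]]]; first by exists (r ** t); rewrite nmorphM.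
exists (r ** t), [seq (r *> z.1, z.2) | z <- s]; split=> [z|].
  by case/mapP=> w /sE ? ->.
rewrite nmulDr nmorphM nmul_sumr big_map; congr (_ + _).
by apply: eq_bigr => z _; rewrite cov_T_lact nmulA.
Qed.

Lemma creation_part_ract m r x :
  creation_part m x -> creation_part m (x ** sigma r).
Proof.
elim: m x => [|m IH] x [t]; first by move=> ->; exists (t ** r); rewrite nmorphM.
case=> s [sE ->].
exists (t ** r), [seq (z.1, z.2 ** sigma r) | z <- s]; split=> [z|].
  by case/mapP=> w /sE ? ->; exact: IH.
rewrite nmulDl nmorphM nmul_suml big_map; congr (_ + _).
by apply: eq_bigr => z _; rewrite nmulA.
Qed.

(** Without a unit in [R], the final factor [sigma r] has to come from (FS): each [S z.2 ** T q] is
    [sigma (psi z.2 q)]. *)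
Lemma creation_part_T q : creation_part 1 (T q).
Proof.
have [s /(_ q (mem_head _ _)) sE] := FS_left_unit [:: q].
exists 0, [seq (z.1, S z.2 ** T q) | z <- s]; split=> [z|].
  by case/mapP=> w _ ->; exists (psi w.2 q); rewrite cov_psi.
by rewrite raddf0 add0r big_map -{1}sE.
Qed.

Lemma creation_part_mulT m q x :
  creation_part m x -> creation_part m.+1 (x ** T q).
Proof.
have h r : creation_part 1 (sigma r ** T q).
  by rewrite -cov_T_lact; exact: creation_part_T.
elim: m x => [|m IH] x [r]; first by move=> ->.
case=> s [sE ->]; rewrite nmulDl.
apply: creation_partD.
  exact: creation_part_leq (h r).
exists 0, [seq (z.1, z.2 ** T q) | z <- s]; split=> [z|].
  by case/mapP=> w /sE ? ->; exact: IH.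
rewrite raddf0 add0r big_map nmul_suml.
by apply: eq_bigr => z _; rewrite nmulA.
Qed.

(* [normal_ordered n] consists of the sums of products                        *)
(* [a ** S p1 ** ... ** S pk] with [a] in some [creation_part] and [k <= n].  *)
Fixpoint normal_ordered (n : nat) (x : B) : Prop :=
  if n is n'.+1 then
    exists m (a : B) (s : seq (B * P)),
      [/\ creation_part m a, (forall z, z \in s -> normal_ordered n' z.1) &
          x = a + \sum_(z <- s) z.1 ** S z.2]
  else exists m, creation_part m x.

Lemma normal_ordered_creation n m x : creation_part m x -> normal_ordered n x.
Proof.
case: n => [|n] mx; exists m => //; exists x, [::].
by split=> //; rewrite big_nil addr0.
Qed.

Lemma normal_orderedS n x : normal_ordered n x -> normal_ordered n.+1 x.
Proof.
elim: n x => [|n IH] x [m]; first exact: normal_ordered_creation.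
by case=> a [s [ma sE ->]]; exists m, a, s; split=> // z /sE /IH.
Qed.

Lemma normal_ordered_leq m n x :
  (m <= n)%N -> normal_ordered m x -> normal_ordered n x.
Proof.
by move=> /subnK <-; elim: (n - m)%N => [//|k IH] /IH; exact: normal_orderedS.
Qed.

Lemma normal_orderedB n x y :
  normal_ordered n x -> normal_ordered n y -> normal_ordered n (x - y).
Proof.
have cB m m' a a' : creation_part m a -> creation_part m' a' ->
    creation_part (maxn m m') (a - a').
  move=> ma ma'; apply: creation_partB.
    exact: creation_part_leq (leq_maxl _ _) ma.
  exact: creation_part_leq (leq_maxr _ _) ma'.
case: n => [[m mx] [m' my]|n [m [a [s [ma sE ->]]]] [m' [a' [s' [ma' sE' ->]]]]].
  by exists (maxn m m'); exact: cB.
exists (maxn m m'), (a - a'), (s ++ [seq (z.1, - z.2) | z <- s']); split.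
- exact: cB.
- by move=> z; rewrite mem_cat => /orP[/sE //|/mapP[w /sE' ? ->]].
rewrite big_cat big_map opprD addrACA -sumrN; congr (_ + (_ + _)).
by apply: eq_bigr => z _; rewrite /= raddfN nmulNr.
Qed.

Lemma normal_ordered0 n : normal_ordered n 0.
Proof.
by apply: (@normal_ordered_creation _ 0); exact: creation_part0.
Qed.

Lemma normal_orderedD n x y :
  normal_ordered n x -> normal_ordered n y -> normal_ordered n (x + y).
Proof.
move=> nx ny; rewrite -[y]opprK -[- y]sub0r; apply: normal_orderedB => //.
by apply: normal_orderedB => //; exact: normal_ordered0.
Qed.

Lemma normal_ordered_sum n (I : eqType) (s : seq I) (F : I -> B) :
  (forall i, i \in s -> normal_ordered n (F i)) ->
  normal_ordered n (\sum_(i <- s) F i).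
Proof.
move=> nF; rewrite big_seq; apply: big_ind => //; first exact: normal_ordered0.
exact: normal_orderedD.
Qed.

Lemma normal_ordered_mulR n r x :
  normal_ordered n x -> normal_ordered n (x ** sigma r).
Proof.
case: n => [[m mx]|n [m [a [s [ma sE ->]]]]].
  by exists m; exact: creation_part_ract.
exists m, (a ** sigma r), [seq (z.1, z.2 <* r) | z <- s]; split.
- exact: creation_part_ract.
- by move=> z /mapP[w /sE ? ->].
rewrite nmulDl nmul_suml big_map; congr (_ + _).
by apply: eq_bigr => z _; rewrite cov_S_ract nmulA.
Qed.

(** Contracting the last [S] with [T q] leaves a [sigma], so one annihilation operator disappears.
    For [n = 0] there is none to remove, and only the creation part grows. *)
Lemma normal_ordered_mulT n q x :
  normal_ordered n x -> normal_ordered n.-1 (x ** T q).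
Proof.
case: n => [[m mx]|n [m [a [s [ma sE ->]]]]] /=.
  by exists m.+1; exact: creation_part_mulT.
rewrite nmulDl; apply: normal_orderedD.
  by apply: normal_ordered_creation; exact: creation_part_mulT ma.
rewrite nmul_suml; apply: normal_ordered_sum => z /sE nz.
by rewrite -nmulA -cov_psi; exact: normal_ordered_mulR.
Qed.

Lemma normal_ordered_mulS n p x :
  normal_ordered n x -> normal_ordered n.+1 (x ** S p).
Proof.
move=> nx; exists 0, 0, [:: (x, p)]; split=> [|z|].
- exact: creation_part0.
- by rewrite inE => /eqP ->.
- by rewrite big_seq1 add0r.
Qed.

Lemma normal_ordered_S p : normal_ordered 1 (S p).
Proof.
have [s /(_ p (mem_head _ _)) <-] := FS_right_unit [:: p].
apply: normal_ordered_sum => z _; apply: normal_ordered_mulS.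
by rewrite -cov_psi; exists 0; exists (psi p z.1).
Qed.

Lemma normal_ordered_exists : cov_surjective C ->
  forall x : B, exists n, normal_ordered n x.
Proof.
move=> surj x; pose no y := exists n, normal_ordered n y.
have noB y z : no y -> no z -> no (y - z).
  move=> [n ny] [k kz]; exists (maxn n k); apply: normal_orderedB.
    exact: normal_ordered_leq (leq_maxl _ _) ny.
  exact: normal_ordered_leq (leq_maxr _ _) kz.
suff: smallest is_subring (range sigma `|` range T `|` range S) `<=`
    [set y | no y /\ forall z, no z -> no (z ** y)].
  by rewrite surj => /(_ x I) [].
apply: smallest_sub => [|_ [[]|] [y _ <-]].
- split; first split=> [|y z [ny yM] [nz zM]].
  + split=> [|z _]; first by exists 0; exact: normal_ordered0.
    by rewrite nmul0r; exists 0; exact: normal_ordered0.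
  + split=> [|w nw]; first exact: noB.
    by rewrite nmulDr nmulNr; apply: noB; [exact: yM|exact: zM].
  + move=> y z [ny yM] [nz zM]; split=> [|w nw]; first exact: zM.
    by rewrite nmulA; apply/zM/yM.
- split=> [|z [n nz]]; first by exists 0; exists 0; exists y.
  by exists n; exact: normal_ordered_mulR.
- split=> [|z [n nz]]; first by exists 0; exists 1; exact: creation_part_T.
  by exists n.-1; exact: normal_ordered_mulT.
- split=> [|z [n nz]]; first by exists 1; exact: normal_ordered_S.
  by exists n.+1; exact: normal_ordered_mulS.
Qed.

End FiniteRank.

(** * Faithfulness of the action on the Fock space *)

Section FockFaithful.
Variables (R : nuRingType) (X : rsystem R).
Hypotheses (hR : right_nondegenerate R) (hFS : conditionFS X).
Variables (C : covrep X) (f : {nurmorphism cov_ring C -> cov_ring (fock X)}).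
Hypothesis fE : cov_intertwines f.
Local Notation P := (sysP X).
Local Notation Q := (sysQ X).
Local Notation B := (cov_ring C).
Local Notation S := (cov_S C).
Local Notation T := (cov_T C).
Local Notation sigma := (cov_sigma C).

Definition fock_act (x : B) (v : fock_space X) : fock_space X :=
  (val (f x : fock_ring X) : rend (fock_space X)) v.

Lemma fock_actD x y v : fock_act (x + y) v = fock_act x v + fock_act y v.
Proof.
by rewrite /fock_act raddfD; set a := f x; set b := f y; rewrite [val _]raddfD.
Qed.

Lemma fock_act0 v : fock_act 0 v = 0.
Proof. by rewrite /fock_act raddf0. Qed.

Lemma fock_actM x y v : fock_act (x ** y) v = fock_act x (fock_act y v).
Proof. by rewrite /fock_act nmorphM. Qed.

Lemma fock_act_r0 x : fock_act x 0 = 0.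
Proof. by apply: (@addrI _ (fock_act x 0)); rewrite -rendD !addr0. Qed.

Lemma fock_act_sum I (s : seq I) (F : I -> B) v :
  fock_act (\sum_(i <- s) F i) v = \sum_(i <- s) fock_act (F i) v.
Proof. exact: (big_morph (fock_act^~ v) (fun x y => fock_actD x y v) (fock_act0 v)). Qed.

Lemma fock_act_sigma r v n : dcoord n (fock_act (sigma r) v) = r *> dcoord n v.
Proof. by case: fE => fR _ _; rewrite /fock_act fR. Qed.

Lemma fock_act_T0 q v : dcoord 0 (fock_act (T q) v) = 0.
Proof. by case: fE => _ fT _; rewrite /fock_act fT. Qed.

(** As [R] may lack a unit, no single vacuum vector is singled out; the whole degree 0 summand takes
    its place. *)
Definition vacuum (v : fock_space X) : Prop := forall n, dcoord n.+1 v = 0.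

Lemma fock_act_S_vacuum p v : vacuum v -> fock_act (S p) v = 0.
Proof.
case: fE => _ _ fS v0; rewrite /fock_act fS; apply: dsum_ext => n.
by rewrite -[LHS]/(@annihilation R X p n (dcoord n.+1 v)) v0 annihilation0.
Qed.

Definition vacuum_fun (r : R) (n : nat) : tensor_pow X n :=
  if n is 0 then r else 0.

Lemma vacuum_finsupp r : finsupp (vacuum_fun r).
Proof. by exists 1 => -[]. Qed.

Lemma creation_part_faithful m x : creation_part m x ->
  (forall v, vacuum v -> fock_act x v = 0) -> x = 0.
Proof.
(* On the degree 0 vector [s], the degree 0 component of [sigma r + y] is [r ** s], so
   non-degeneracy applies. *)
have r0 r y : (forall v, dcoord 0 (fock_act y v) = 0) ->
    (forall v, vacuum v -> fock_act (sigma r + y) v = 0) -> r = 0.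
  move=> y0 h; apply: hR => s.
  have /h /(congr1 (@dcoord _ _ 0)) : vacuum (dsum_of (vacuum_finsupp s)) by [].
  by rewrite fock_actD dcoordD y0 fock_act_sigma addr0.
elim: m x => [|m IH] x [r].
  move=> -> h; rewrite (r0 r 0) ?raddf0 // => v; first by rewrite fock_act0.
  by rewrite addr0; exact: h.
case=> s [sE ->] h.
have y0 v : dcoord 0 (fock_act (\sum_(z <- s) T z.1 ** z.2) v) = 0.
  rewrite fock_act_sum (big_morph _ (@dcoordD _ _ 0) (dcoord0 _ 0)).
  by rewrite big1 // => z _; rewrite fock_actM fock_act_T0.
have r_0 := r0 _ _ y0 h; rewrite r_0 raddf0 add0r in h *.
set y := \sum_(z <- s) _ in h *.
have [e eE] := FS_left_unit C hFS [seq z.1 | z <- s].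
(* Every summand of [y] begins with some [T z.1], on which [e] acts as a left unit. *)
have -> : y = \sum_(w <- e) T w.1 ** (S w.2 ** y).
  under eq_bigr do rewrite nmulA nmul_sumr.
  rewrite exchange_big /= [LHS]big_seq [RHS]big_seq; apply: eq_bigr => z zs.
  rewrite -{1}(eE z.1) ?map_f // nmul_suml.
  by apply: eq_bigr => w _; rewrite !nmulA.
(* [S w.2] contracts with each leading [T z.1], so [S w.2 ** y] lies in [creation_part m] and still
   kills the vacuum. *)
rewrite big1 // => w _; rewrite [_ ** y]IH ?nmul0r // => [|v /h yv].
  rewrite nmul_sumr.
  rewrite big_seq; apply: big_ind => [||z /sE mz].
  - exact: creation_part0.
  - exact: creation_partD.
  by rewrite nmulA -cov_psi; exact: creation_part_lact.
by rewrite fock_actM yv fock_act_r0.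
Qed.

Lemma normal_ordered_faithful n x : normal_ordered n x -> f x = 0 -> x = 0.
Proof.
elim: n x => [|n IH] x [m].
  move=> mx fx; apply: creation_part_faithful mx _ => v _.
  by rewrite /fock_act fx.
case=> a [s [ma sE xE]] fx.
(* The other summands end in an annihilation operator, so on the vacuum [x] acts as [a]. *)
have a0 : a = 0.
  apply: creation_part_faithful ma _ => v v0.
  have : fock_act x v = 0 by rewrite /fock_act fx.
  rewrite xE fock_actD fock_act_sum big1 ?addr0 // => z _.
  by rewrite fock_actM fock_act_S_vacuum // fock_act_r0.
have [e eE] := FS_right_unit C hFS [seq z.2 | z <- s].
have -> : x = \sum_(w <- e) x ** T w.1 ** S w.2.
  rewrite xE a0 add0r; under [RHS]eq_bigr do rewrite -nmulA nmul_suml.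
  rewrite exchange_big /= [LHS]big_seq [RHS]big_seq; apply: eq_bigr => z zs.
  rewrite -{1}(eE z.2) ?map_f // nmul_sumr.
  by apply: eq_bigr => w _; rewrite !nmulA.
(* [x ** T w.1] has one annihilation operator fewer and stays in the kernel of [f]. *)
rewrite big1 // => w _; rewrite [x ** _]IH ?nmul0l //.
  by apply: (@normal_ordered_mulT _ _ _ hFS n.+1); exists m, a, s.
by rewrite nmorphM fx nmul0l.
Qed.

End FockFaithful.

(** * The isomorphism, as the inverse of the universal homomorphism *)

Theorem proposition4p2 (R : nuRingType) (X : rsystem R)
  (hR : right_nondegenerate R) (hFS : conditionFS X)
  (T : covrep X) (hT : is_toeplitz T) :
  cov_isomorphic (fock X) T.
Proof.
have [Tsurj /(_ (fock X)) [[f fE] _]] := hT.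
have f_inj : injective f.
  move=> x y fxy; apply/eqP; rewrite -subr_eq0; apply/eqP.
  have [n nxy] := normal_ordered_exists hFS Tsurj (x - y).
  by apply: (normal_ordered_faithful hR hFS fE nxy); rewrite raddfB /= fxy subrr.
have f_surj y : exists x, f x = y.
  have [fR fT fS] := fE.
  suff: smallest is_subring (range (cov_sigma (fock X)) `|` range (cov_T (fock X))
      `|` range (cov_S (fock X))) `<=` range f.
    by rewrite fock_surjective => /(_ y I) [x _ <-]; exists x.
  apply: smallest_sub => [|_ [[]|] [z _ <-]].
  - split; first split.
    + by exists 0 => //; rewrite raddf0.
    + by move=> _ _ [u _ <-] [v _ <-]; exists (u - v) => //; rewrite raddfB.
    + by move=> _ _ [u _ <-] [v _ <-]; exists (u ** v) => //; rewrite nmorphM.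
  - by exists (cov_sigma T z).
  - by exists (cov_T T z).
  - by exists (cov_S T z).
(* Choice picks preimages under [f]; injectivity of [f] transfers the algebraic identities to
   [g]. *)
have [g gK] := choice f_surj.
have fK : cancel f g by move=> x; apply: f_inj; rewrite gK.
have gD : nmod_morphism g.
  split=> [|x y]; apply: f_inj; rewrite [LHS]gK; first by rewrite raddf0.
  by rewrite raddfD /= !gK.
have gM : {morph g : x y / x ** y}.
  by move=> x y; apply: f_inj; rewrite nmorphM !gK.
pose mD := GRing.isNmodMorphism.Build _ _ g gD.
pose mM := isNuMultiplicative.Build _ _ g gM.
pose phi : {nurmorphism cov_ring (fock X) -> cov_ring T} := HB.pack g mD mM.
exists phi; split; first by exists f.
by have [fR fT fS] := fE; split=> z; apply: f_inj; rewrite [LHS]gK.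
Qed.
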